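(* Let $D\subset\mathbb{C}^n$ be a B-regular domain and let $A\subset\partial D$ be b-pluripolar. Then $$\hat A\cap\partial D=A.$$
   Context: $\mathrm{PSH}(D)$ denotes the family of all plurisubharmonic functions on $D$. For $u:D\to\mathbb{R}\cup\{-\infty\}$ and $x\in\overline D$, $u^*(x)=\limsup_{z\to x,\,z\in D}u(z)=\lim_{r\to0}\sup_{B(x,r)\cap D}u$. A bounded domain $D\subset\mathbb{C}^n$ is B-regular if every $f\in C(\partial D)$ can be extended to a plurisubharmonic function on $D$ that is continuous on $\overline D$. A set $A\subset\partial D$ is b-pluripolar if there exists $u\in\mathrm{PSH}(D)$, $u\le0$, $u\not\equiv-\infty$, such that $u^*=-\infty$ on $A$. The b-pluripolar hull of a b-pluripolar set $A\subset\partial D$ is $$\hat A=\{z\in\overline D:\ u^*(z)=-\infty\text{ for all }u\in\mathrm{PSH}(D)\text{ with }u\not\equiv-\infty,\ u<0,\ u^*|_A=-\infty\}.$$ *)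

(* Defs.v *)
From HB Require Import structures.
From mathcomp Require Import all_boot all_order all_algebra.
From mathcomp Require Import all_classical all_reals all_analysis.
From mathcomp Require Import complex.

Set Implicit Arguments.
Unset Strict Implicit.
Unset Printing Implicit Defensive.

Import Order.TTheory GRing.Theory Num.Theory.
Import numFieldNormedType.Exports.

Local Open Scope classical_set_scope.
Local Open Scope complex_scope.
Local Open Scope ring_scope.

(* R[i] itself carries no topology in the libraries: [R[i]^o] is the complex
   field normed by its modulus, and ['rV[R[i]^o]_n] is C^n with the sup norm
   (same open sets and bounded sets as for the Euclidean norm).

   A function D -> [-oo, +oo[ is a total function into [\bar R]; its values
   outside D are never used. *)

Definition bdry {T : topologicalType} (D : set T) : set T :=
  closure D `\` interior D.

Definition usc_on {R : realType} {T : topologicalType} (D : set T)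
    (u : T -> \bar R) : Prop :=
  forall x, D x -> forall c : R, (u x < c%:E)%E ->
    \forall y \near within D (nbhs x), (u y < c%:E)%E.

(* The integrand is bounded above whenever v is usc on the circle, so that the
   integral is never of the form +oo - oo; it may be -oo. *)
Definition circle_mean {R : realType} (v : R[i]^o -> \bar R) (c : R[i]^o)
    (r : R) : \bar R :=
  (((2 * pi)^-1)%R%:E *
   \int[lebesgue_measure]_(t in `[0%R, (2 * pi)%R])
     v (c + r%:C * (cos t +i* sin t))%R)%E.

(* The function identically -oo is allowed here and in [psh]. *)
Definition subharmonic {R : realType} (W : set R[i]^o) (v : R[i]^o -> \bar R)
    : Prop :=
  [/\ forall z, W z -> (v z < +oo)%E,
      usc_on W v &
      forall (c : R[i]^o) (r : R), 0 < r ->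
        [set z : R[i]^o | `|z - c| <= r%:C] `<=` W ->
        (v c <= circle_mean v c r)%E].

Definition psh {R : realType} {n : nat} (D : set 'rV[R[i]^o]_n)
    (u : 'rV[R[i]^o]_n -> \bar R) : Prop :=
  [/\ forall z, D z -> (u z < +oo)%E,
      usc_on D u &
      forall a b : 'rV[R[i]^o]_n,
        subharmonic [set w : R[i]^o | D (a + w *: b)]
                    (fun w => u (a + w *: b))].

Definition not_identically_Noo {R : realType} {T : Type} (D : set T)
    (u : T -> \bar R) : Prop :=
  exists2 z, D z & u z != -oo%E.

(* u^*(x); the neighbourhoods of x are not punctured, so for x in D the value
   u x is taken into account. *)
Definition usc_reg {R : realType} {n : nat} (D : set 'rV[R[i]^o]_n)
    (u : 'rV[R[i]^o]_n -> \bar R) (x : 'rV[R[i]^o]_n) : \bar R :=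
  limf_esup u (within D (nbhs x)).

Definition domain {R : realType} {n : nat} (D : set 'rV[R[i]^o]_n) : Prop :=
  [/\ open D, connected D & D !=set0].

Definition B_regular {R : realType} {n : nat} (D : set 'rV[R[i]^o]_n) : Prop :=
  [/\ domain D, bounded_set D &
      forall f : 'rV[R[i]^o]_n -> R, {within bdry D, continuous f} ->
        exists F : 'rV[R[i]^o]_n -> R,
          [/\ psh D (EFin \o F),
              {within closure D, continuous F} &
              forall x, bdry D x -> F x = f x]].

Definition b_pluripolar {R : realType} {n : nat} (D A : set 'rV[R[i]^o]_n)
    : Prop :=
  A `<=` bdry D /\
  exists u : 'rV[R[i]^o]_n -> \bar R,
    [/\ psh D u,
        forall z, D z -> (u z <= 0)%E,
        not_identically_Noo D u &
        forall a, A a -> usc_reg D u a = -oo%E].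

Definition b_hull {R : realType} {n : nat} (D A : set 'rV[R[i]^o]_n)
    : set 'rV[R[i]^o]_n :=
  [set z | closure D z /\
    forall u : 'rV[R[i]^o]_n -> \bar R,
      psh D u ->
      not_identically_Noo D u ->
      (forall x, D x -> (u x < 0)%E) ->
      (forall a, A a -> usc_reg D u a = -oo%E) ->
      usc_reg D u z = -oo%E].

(* Main.v *)
Require Import Defs.
From mathcomp Require Import all_boot all_order all_algebra.
From mathcomp Require Import all_classical all_reals all_analysis.
From mathcomp Require Import measurable_realfun.
From mathcomp Require Import complex ring lra.

Set Implicit Arguments.
Unset Strict Implicit.
Unset Printing Implicit Defensive.

Import Order.TTheory GRing.Theory Num.Theory.
Import numFieldNormedType.Exports.

Local Open Scope classical_set_scope.
Local Open Scope complex_scope.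
Local Open Scope ring_scope.

(** One inclusion is immediate. For the other, let z0 be a boundary point
    outside A; a negative plurisubharmonic function is needed that tends to -oo
    at every point of A but not at z0. Two ingredients are available: a
    plurisubharmonic u <= 0, not identically -oo, that tends to -oo on A (but
    possibly at z0 as well), and a peak function phi at z0: plurisubharmonic,
    continuous on the closure of D, with phi z0 = 0 and
    phi z <= - |z - z0|^2 on D. The latter is the extension given by
    B-regularity of the boundary function - |z - z0|^2; the upper bound is a
    maximum principle (psh_le_sqnorm), proved by averaging over circles in
    the complex line that joins an interior maximum point to z0.

    Since D is connected, {u = -oo} has empty interior (psh_Noo_open), so there
    are points z_j of D tending to z0 with u z_j > -oo and
    phi z_j > - 1 / (j + 1). Choose e_j > 0 with e_j * u z_j >= -1 and put
      v = sup_j v_j,   v_j = e_j * u + (j + 1) * phi.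
    Then v z_j >= v_j z_j >= -2, so the limsup of v at z0 is at least -2. Away
    from z0, phi is locally bounded above by a negative constant, so the v_j
    tend to -oo locally uniformly, and bounding v from above near such a point
    only involves finitely many indices (near_penalized_sup_le). Hence v is
    upper semicontinuous on D, thus plurisubharmonic as a supremum of
    plurisubharmonic functions, and v still tends to -oo at every point of A.
    So v excludes z0 from the hull. *)

(* The homonyms from the theory of closed number fields are shadowed: here Re
   and Im are valued in R. *)
Local Notation Re := complex.Re.
Local Notation Im := complex.Im.

(** * The topology of complex space *)

Lemma ler_mx_entry_norm (K : numDomainType) (m n : nat) (x : 'M[K]_(m, n)) i j :
  `|x i j| <= `|x|.
Proof.
rewrite [leRHS]/Num.Def.normr /= mx_normE -[leLHS]normr_id -num_abs_le//.
by apply/bigmax_geP; right; exists (i, j) => //=; rewrite num_abs_le// normr_id.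
Qed.

Lemma continuous_complex_of_pair (R : realType) :
  continuous (fun p : R * R => p.1 +i* p.2 : R[i]^o).
Proof.
move=> p; apply/(@cvgrPdist_lt _ R[i]^o) => e e0.
have ee : e = (Re e)%:C by rewrite RRe_real// gtr0_real.
have e20 : 0 < Re e / 2 by rewrite divr_gt0// -ltcR -ee.
near=> q; rewrite ee normc_def ltcR /=.
have h1 : `|p.1 - q.1| < Re e / 2.
  by near: q; apply: (@cvgr_dist_lt _ R^o) => //; exact: cvg_fst.
have h2 : `|p.2 - q.2| < Re e / 2.
  by near: q; apply: (@cvgr_dist_lt _ R^o) => //; exact: cvg_snd.
rewrite -(@ltr_pXn2r _ 2)// ?nnegrE ?sqrtr_ge0 ?(ltW (_ : 0 < Re e))//; last first.
  by rewrite -ltcR -ee.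
rewrite sqr_sqrtr ?addr_ge0 ?sqr_ge0//.
move: h1 h2; rewrite !ltr_norml => /andP[h1 h2] /andP[h3 h4]; nra.
Unshelve. all: by end_near. Qed.

Lemma continuous_Re (R : realType) : continuous (@Re R : R[i]^o -> R^o).
Proof.
move=> z; apply/(@cvgrPdist_lt _ R^o _ (nbhs (z : R[i]^o)) (nbhs_filter _)) => e e0.
have eC : 0 < e%:C by rewrite ltcR.
near=> w; rewrite -ltcR -raddfB; apply: le_lt_trans (normc_ge_Re _) _.
near: w; exact: (@nbhsx_ballx _ R[i]^o).
Unshelve. all: by end_near. Qed.

Lemma continuous_circle (R : realType) (c : R[i]^o) (r : R) :
  continuous (fun t : R => c + r%:C * (cos t +i* sin t) : R[i]^o).
Proof.
have cs : continuous (fun t : R => cos t +i* sin t : R[i]^o).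
  move=> t.
  have ct : {for t, continuous (fun t : R => (cos t, sin t))}.
    exact: (cvg_pair (@continuous_cos R t) (@continuous_sin R t)).
  exact: (continuous_comp ct (@continuous_complex_of_pair R (cos t, sin t))).
move=> t; apply: (@cvgD _ R[i]^o _ _ _ (fun=> c)); first exact: cvg_cst.
apply: (@cvgM R[i] _ _ _ (fun=> r%:C)); first exact: cvg_cst.
exact: cs.
Qed.

Lemma normc_cos_sin (R : realType) (t : R) : `|cos t +i* sin t| = 1 :> R[i].
Proof. by rewrite normc_def /= cos2Dsin2 sqrtr1. Qed.

(** Reduces to real segments: the coordinates lie in a square, the image of a
    product of two segments under (x, y) |-> x + i y. *)
Lemma closed_bounded_compact_complex (R : realType) (n : nat)
  (K : set 'rV[R[i]^o]_n) : bounded_set K -> closed K -> compact K.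
Proof.
move=> [M [Mreal KM]] Kcl.
pose S : set R[i]^o :=
  (fun p : R * R => p.1 +i* p.2 : R[i]^o) @`
    (`[- Re (M + 1), Re (M + 1)] `*` `[- Re (M + 1), Re (M + 1)]).
have Sc : compact S.
  apply: continuous_compact.
    by apply: continuous_subspaceT; exact: continuous_complex_of_pair.
  by apply: compact_setX; exact: segment_compact.
have := @rV_compact _ n (fun=> S) (fun=> Sc).
move=> /(subclosed_compact Kcl); apply => v /KM vM i.
have vi : `|v ord0 i| <= M + 1.
  apply: le_trans (vM (M + 1) _); last by rewrite ltrDl.
  exact: ler_mx_entry_norm.
have [y y0 My] : exists2 y, 0 <= y & M + 1 = y%:C.
  exists (Re (M + 1)); last by rewrite RRe_real// ger0_real// (le_trans (normr_ge0 _) vi).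
  by have := le_trans (normr_ge0 _) vi; rewrite lecE => /andP[].
exists (Re (v ord0 i), Im (v ord0 i)); last by case: (v ord0 i).
move: vi; rewrite My normc_def lecR /= => vi.
by split; rewrite /= in_itv /= -ler_norml -sqrtr_sqr; apply: le_trans vi;
  rewrite ler_wsqrtr// ?lerDl ?lerDr sqr_ge0.
Qed.

Lemma bounded_closure (R : realType) (n : nat) (D : set 'rV[R[i]^o]_n) :
  bounded_set D -> bounded_set (closure D).
Proof.
move=> [M [Mreal DM]]; exists (M + 1); split; first by rewrite realD.
move=> x Mx z /= Dz.
have [d [Dd zd]] := Dz _ (@nbhsx_ballx _ 'rV[R[i]^o]_n z 1 ltr01).
have : `|d| <= x - 1 by apply: DM => //; rewrite ltrBrDr.
rewrite -[X in _ -> `|X| <= _](subrK d) => dx.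
apply: le_trans (ler_normD _ _) _.
rewrite -(subrK 1 x) addrC; apply: lerD => //.
by move: zd; rewrite -ball_normE /= => /ltW.
Qed.

Lemma continuous_line (R : realType) (n : nat) (a b : 'rV[R[i]^o]_n) :
  continuous (fun w : R[i]^o => a + w *: b).
Proof.
move=> w; have sb := @scalel_continuous _ 'rV[R[i]^o]_n b w.
exact: (@cvgD _ 'rV[R[i]^o]_n _ _ _ (fun=> a) _ _ _ (cvg_cst a) sb).
Qed.

Lemma continuous_circle_line (R : realType) (n : nat) (a b : 'rV[R[i]^o]_n)
    (c : R[i]^o) (r : R) :
  continuous (fun t : R => a + (c + r%:C * (cos t +i* sin t) : R[i]^o) *: b).
Proof.
move=> t.
have := @continuous_circle R c r t.
have := @continuous_line R n a b (c + r%:C * (cos t +i* sin t)) => /[swap].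
exact: continuous_comp.
Qed.

(** * Circle means *)

Section integral_facts.
Import HBNNSimple.

(** Holds without measurability, because the integral of a nonnegative function
    is defined as a supremum over the simple functions below it. *)
Lemma le_integral_pointwise d (T : measurableType d) (R : realType)
  (mu : {measure set T -> \bar R}) (D : set T) (f g : T -> \bar R) :
  (forall x, D x -> (f x <= g x)%E) ->
  (\int[mu]_(x in D) f x <= \int[mu]_(x in D) g x)%E.
Proof.
have ge0_mono (h k : T -> \bar R) : (forall x, D x -> 0 <= h x)%E ->
    (forall x, D x -> (h x <= k x)%E) ->
    (\int[mu]_(x in D) h x <= \int[mu]_(x in D) k x)%E.
  move=> h0 hk; have k0 x : D x -> (0 <= k x)%E by move=> Dx; rewrite (le_trans (h0 _ Dx))// hk.
  rewrite !ge0_integralE//; apply: ereal_sup_le => _ [s sh <-].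
  exists s => // x; apply: le_trans (sh x) _.
  by rewrite /patch; case: ifPn => // /set_mem; exact: hk.
move=> fg; rewrite [leLHS]integralE [leRHS]integralE; apply: leeB.
  apply: ge0_mono => x Dx; first exact: funepos_ge0.
  by apply: (@funepos_le _ _ D) (mem_set Dx) => y /set_mem; exact: fg.
apply: ge0_mono => x Dx; first exact: funeneg_ge0.
by apply: (@funeneg_le _ _ D) (mem_set Dx) => y /set_mem; exact: fg.
Qed.

(** Additivity for nonpositive functions, which may have integral -oo and
    therefore need not be integrable. *)
Lemma le0_integralD d (T : measurableType d) (R : realType)
  (mu : {measure set T -> \bar R}) (D : set T) (f g : T -> \bar R) : measurable D ->
  (forall x, D x -> f x <= 0)%E -> (forall x, D x -> g x <= 0)%E ->
  measurable_fun D f -> measurable_fun D g ->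
  (\int[mu]_(x in D) (f x + g x) = \int[mu]_(x in D) f x + \int[mu]_(x in D) g x)%E.
Proof.
move=> mD f0 g0 mf mg.
have mN h : measurable_fun D h -> measurable_fun D (fun x => - h x)%E.
  by move=> mh; apply: (measurableT_comp _ mh); exact: oppe_measurable.
have N h : (forall x, D x -> h x <= 0)%E ->
    (\int[mu]_(x in D) h x = - \int[mu]_(x in D) (- h x))%E.
  move=> h0; rewrite -integral_ge0N => [|x Dx]; last by rewrite oppe_ge0 h0.
  by apply: eq_integral => x _; rewrite oppeK.
have fgD x : D x -> (f x +? g x)%E.
  move=> Dx; apply: ltpinfty_adde_def; rewrite inE /=.
    exact: le_lt_trans (f0 x Dx) (ltry _).
  exact: le_lt_trans (g0 x Dx) (ltry _).
rewrite N => [|x Dx]; last by rewrite adde_le0 ?f0 ?g0.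
rewrite (N f)// (N g)// -oppeD; last first.
  by rewrite ge0_adde_def// inE integral_ge0// => x Dx; rewrite oppe_ge0 ?f0 ?g0.
rewrite -ge0_integralD//; [| |exact: mN| |exact: mN].
- congr (- _)%E; apply: eq_integral => x /set_mem Dx.
  by rewrite oppeD// fgD.
- by move=> x Dx; rewrite oppe_ge0 f0.
- by move=> x Dx; rewrite oppe_ge0 g0.
Qed.

Lemma le0_integralZl d (T : measurableType d) (R : realType)
  (mu : {measure set T -> \bar R}) (D : set T) (f : T -> \bar R) (k : R) :
  measurable D -> (forall x, D x -> f x <= 0)%E -> measurable_fun D f -> 0 <= k ->
  (\int[mu]_(x in D) (k%:E * f x) = k%:E * \int[mu]_(x in D) f x)%E.
Proof.
move=> mD f0 mf k0.
have mN : measurable_fun D (fun x => - f x)%E.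
  by apply: (measurableT_comp _ mf); exact: oppe_measurable.
have E h : (\int[mu]_(x in D) (h x) = \int[mu]_(x in D) (- - h x))%E.
  by apply: eq_integral => x _; rewrite oppeK.
rewrite E integral_ge0N => [|x Dx]; last by rewrite -muleN mule_ge0// oppe_ge0 f0.
rewrite [in RHS]E [X in _ = (_ * X)%E]integral_ge0N; last first.
  by move=> x Dx; rewrite oppe_ge0 f0.
rewrite muleN -ge0_integralZl//; last by move=> x Dx; rewrite oppe_ge0 f0.
by congr (- _)%E; apply: eq_integral => x _; rewrite muleN.
Qed.

End integral_facts.

Section circle_mean.
Context {R : realType}.
Implicit Types (f g : R[i]^o -> \bar R) (c : R[i]^o) (r : R).

Local Notation circle c r := (fun t : R => c + r%:C * (cos t +i* sin t) : R[i]^o).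

Lemma disc_circle c r t : 0 < r ->
  [set z : R[i]^o | `|z - c| <= r%:C] (circle c r t).
Proof.
move=> r0 /=; rewrite addrC addKr normrM normc_cos_sin mulr1 normc_def /= expr0n addr0.
by rewrite sqrtr_sqr gtr0_norm.
Qed.

Lemma inv_2pi_ge0 : (0 <= (2 * pi)^-1 :> R).
Proof. by rewrite invr_ge0 mulr_ge0// pi_ge0. Qed.

Lemma le_circle_mean f g c r : (forall t, f (circle c r t) <= g (circle c r t))%E ->
  (circle_mean f c r <= circle_mean g c r)%E.
Proof.
move=> fg; apply: lee_wpmul2l; first by rewrite lee_fin inv_2pi_ge0.
by apply: le_integral_pointwise.
Qed.

Local Notation measurable_circle f c r :=
  (measurable_fun [set: R] (fun t : R => f%function (circle c r t) : \bar R)).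

Lemma usc_on_circle_measurable (W : set R[i]^o) f c r : usc_on W f -> 0 < r ->
  [set z : R[i]^o | `|z - c| <= r%:C] `<=` W -> measurable_circle f c r.
Proof.
move=> uf r0 rW.
rewrite (_ : (fun _ => _) = (fun t => - - f (circle c r t))%E); last first.
  by apply/funext => t; rewrite oppeK.
apply: (@measurableT_comp _ _ _ _ _ _ (fun x : \bar R => - x)%E).
  exact: oppe_measurable.
apply: lower_semicontinuous_measurable => t a.
rewrite lteNr -EFinN => fa.
have := uf _ (rW _ (disc_circle c t r0)) _ fa.
move=> /(@continuous_circle R c r t) /= H.
exists [set s | (f (circle c r s) < (- a)%:E)%E]; last first.
  by move=> s /= fs; rewrite lteNr.
apply: (@filterS _ (nbhs t) (nbhs_filter t) _ _ _ H) => s /=; apply; exact: rW (disc_circle c s r0).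
Qed.

Lemma circle_meanD f g c r :
  (forall t, f (circle c r t) <= 0)%E -> (forall t, g (circle c r t) <= 0)%E ->
  measurable_circle f c r -> measurable_circle g c r ->
  circle_mean (fun z => f z + g z)%E c r = (circle_mean f c r + circle_mean g c r)%E.
Proof.
move=> f0 g0 mf mg; rewrite /circle_mean -muleDr//; last first.
  have le0 h : (forall t, h (circle c r t) <= 0)%E ->
      (\int[lebesgue_measure]_(t in `[0%R, (2 * pi)%R]) h (circle c r t) < +oo)%E.
    move=> h0; apply: (@le_lt_trans _ _ 0%E) => //.
    by rewrite -[leRHS](@integral0 _ _ _ (@lebesgue_measure R) `[0%R, (2 * pi)%R]);
      apply: le_integral_pointwise.
  by apply: ltpinfty_adde_def; rewrite inE /= le0.
by congr (_ * _)%E; apply: le0_integralD => //; apply: measurable_funTS.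
Qed.

Lemma circle_meanZ k f c r : 0 <= k ->
  (forall t, f (circle c r t) <= 0)%E -> measurable_circle f c r ->
  circle_mean (fun z => k%:E * f z)%E c r = (k%:E * circle_mean f c r)%E.
Proof.
move=> k0 f0 mf; rewrite /circle_mean muleCA; congr (_ * _)%E.
by apply: le0_integralZl => //; apply: measurable_funTS.
Qed.

(** The arc 0 <= t <= d has positive length, so it alone contributes -oo, and the
    sign condition prevents the rest of the circle from compensating. *)
Lemma circle_mean_Noo (f : R[i]^o -> \bar R) (c : R[i]^o) (r d : R) : 0 < d ->
  (forall t, f (circle c r t) <= 0)%E ->
  (forall t, 0 <= t <= d -> f (circle c r t) = -oo%E) ->
  circle_mean f c r = -oo%E.
Proof.
move=> d0 f0 foo; set e := Num.min d (2 * pi).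
have pi2 : 0 < 2 * pi :> R by rewrite mulr_gt0// pi_gt0.
have e0 : 0 < e by rewrite lt_min d0.
apply/eqP; rewrite -leeNy_eq /circle_mean.
suff -> : (\int[lebesgue_measure]_(t in `[0%R, (2 * pi)%R])
     f (circle c r t) = -oo)%E.
  by rewrite gt0_muleNy// lte_fin invr_gt0.
apply/eqP; rewrite -leeNy_eq.
apply: (@le_trans _ _ (\int[@lebesgue_measure R]_(t in `[0%R, (2 * pi)%R])
     ((cst -oo%E) \_ `[0%R, e]) t)%E).
  apply: le_integral_pointwise => t _; rewrite /patch; case: ifPn => // /set_mem /=.
  rewrite in_itv /= => /andP[t0 te].
  by rewrite foo// t0 (le_trans te)// ge_min lexx.
rewrite -integral_mkcondr (_ : _ `&` _ = [set` `[0%R, e]]); last first.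
  apply/seteqP; split => t /=; rewrite !in_itv /=; first by case.
  move=> /andP[t0 te]; rewrite t0 te; split=> //.
  by rewrite (le_trans te)// ge_min lexx orbT.
rewrite integral_cst//= lebesgue_measure_itv /= lte_fin e0 oppr0 adde0.
by rewrite gt0_mulNye// lte_fin.
Qed.

Lemma integral_affine_cos (a b : R) :
  (\int[lebesgue_measure]_(t in `[0%R, (2 * pi)%R]) (a + b * cos t)%:E = (a * (2 * pi))%:E)%E.
Proof.
have dF (x : R) : is_derive x (1 : R) (fun t : R => a * t + b * sin t) (a + b * cos x).
  have := is_deriveD (is_deriveZ a (is_derive_id x (1 : R))) (is_deriveZ b (is_derive_sin x)).
  by rewrite /GRing.scale /= mulr1.
rewrite (@continuous_FTC2 _ _ (fun t => a * t + b * sin t)).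
- by rewrite sin0 mulr0 mulr0 addr0 mulr_natl sin2pi mulr0 addr0 sube0.
- by rewrite mulr_gt0// pi_gt0.
- apply: continuous_subspaceT => x.
  apply: (@cvgD _ R^o _ _ _ (fun=> a)); first exact: cvg_cst.
  by apply: (@cvgM R _ _ _ (fun=> b)); [exact: cvg_cst | exact: continuous_cos].
- have cF : continuous (fun t : R => a * t + b * sin t).
    by move=> x; apply: differentiable_continuous; apply/derivable1_diffP; apply: ex_derive.
  split.
  + by move=> x _; apply: ex_derive.
  + by apply: cvg_at_right_filter; exact: cF.
  + by apply: cvg_at_left_filter; exact: cF.
- by move=> x _; rewrite derive1E; apply: derive_val.
Qed.

Lemma circle_mean_affine_cos (f : R[i]^o -> \bar R) c r (a b : R) :
  (forall t, f (circle c r t) = (a + b * cos t)%:E) ->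
  circle_mean f c r = a%:E.
Proof.
move=> fE; rewrite /circle_mean.
under eq_integral do rewrite fE.
rewrite integral_affine_cos -EFinM mulrCA mulVf ?mulr1//.
by rewrite mulf_neq0// ?pnatr_eq0// gt_eqF// pi_gt0.
Qed.

End circle_mean.

(** * Operations on plurisubharmonic functions *)

Section usc.
Context {R : realType} {T : topologicalType}.
Implicit Types (D : set T) (u v : T -> \bar R).

Lemma usc_onZ D u (k : R) : 0 < k -> usc_on D u ->
  usc_on D (fun z => k%:E * u z)%E.
Proof.
move=> k0 uu x Dx c; rewrite -lte_pdivlMl// -EFinM => /(uu x Dx).
by apply: filterS => y; rewrite EFinM lte_pdivlMl.
Qed.

Lemma usc_onD D u v : (forall z, D z -> u z < +oo)%E -> (forall z, D z -> v z < +oo)%E ->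
  usc_on D u -> usc_on D v -> usc_on D (fun z => u z + v z)%E.
Proof.
move=> ufin vfin uu uv x Dx c uvc.
(* split c into strict bounds for the two summands *)
suff [[a b] /= [uxa vxb abc]] : exists p : R * R,
    [/\ (u x < p.1%:E)%E, (v x < p.2%:E)%E & p.1 + p.2 <= c].
  have Ha := uu x Dx a uxa; have Hb := uv x Dx b vxb.
  apply: filterS2 Ha Hb => y ya yb.
  by apply: lt_le_trans (lteD ya yb) _; rewrite -EFinD lee_fin.
move: uvc (ufin x Dx) (vfin x Dx).
case: (u x) => [p||]; case: (v x) => [q||] //=.
- rewrite -EFinD lte_fin => pqc _ _.
  by exists (p + (c - p - q) / 2, q + (c - p - q) / 2) => /=; rewrite !lte_fin; split; lra.
- by move=> _ _ _; exists (p + 1, c - (p + 1)) => /=; rewrite !lte_fin ltNyr; split=> //; lra.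
- by move=> _ _ _; exists (c - (q + 1), q + 1) => /=; rewrite !lte_fin ltNyr; split=> //; lra.
- by move=> _ _ _; exists (c, 0) => /=; rewrite !ltNyr addr0.
Qed.

Lemma usc_on_comp (S : topologicalType) (h : S -> T) D u : continuous h -> usc_on D u ->
  usc_on (h @^-1` D) (u \o h).
Proof.
move=> ch uu x Dx c /(uu _ Dx) H.
have := ch x _ H; apply: (@filterS _ (nbhs x)) => y /= K Dy; exact: K.
Qed.

End usc.

Section subharmonic.
Context {R : realType}.
Implicit Types (W : set R[i]^o) (u v : R[i]^o -> \bar R).

Lemma subharmonicZ W u (k : R) : 0 < k -> (forall z, W z -> u z <= 0)%E ->
  subharmonic W u -> subharmonic W (fun z => k%:E * u z)%E.
Proof.
move=> k0 u0 [ufin uu um]; split.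
- move=> z Wz; apply: (@le_lt_trans _ _ 0%E) => //.
  by apply: mule_ge0_le0; [rewrite lee_fin ltW | exact: u0].
- exact: usc_onZ.
- move=> c r r0 cW; rewrite (circle_meanZ (ltW k0))//.
  + by apply: lee_wpmul2l; [rewrite lee_fin ltW | exact: um].
  + by move=> t; apply/u0/cW/disc_circle.
  + exact: usc_on_circle_measurable cW.
Qed.

Lemma subharmonicD W u v : (forall z, W z -> u z <= 0)%E -> (forall z, W z -> v z <= 0)%E ->
  subharmonic W u -> subharmonic W v -> subharmonic W (fun z => u z + v z)%E.
Proof.
move=> u0 v0 [ufin uu um] [vfin vu vm]; split.
- by move=> z Wz; apply: lte_add_pinfty; [exact: ufin | exact: vfin].
- exact: usc_onD.
- move=> c r r0 cW; rewrite circle_meanD//.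
  + by apply: leeD; [exact: um | exact: vm].
  + by move=> t; apply/u0/cW/disc_circle.
  + by move=> t; apply/v0/cW/disc_circle.
  + exact: usc_on_circle_measurable cW.
  + exact: usc_on_circle_measurable cW.
Qed.

(** Only upper semicontinuity can fail for a supremum: the mean value inequality
    is inherited from each member by monotonicity of the circle mean. *)
Lemma subharmonic_sup (I : Type) W (v : I -> R[i]^o -> \bar R) :
  (forall j, subharmonic W (v j)) ->
  (forall z, W z -> ereal_sup (range (v ^~ z)) < +oo)%E ->
  usc_on W (fun z => ereal_sup (range (v ^~ z))) ->
  subharmonic W (fun z => ereal_sup (range (v ^~ z))).
Proof.
move=> vsh vfin vu; split => // c r r0 cW.
apply: ge_ereal_sup => _ [j _ <-].
have [_ _ vm] := vsh j; apply: le_trans (vm c r r0 cW) _.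
by apply: le_circle_mean => t; apply: ereal_sup_ubound; exists j.
Qed.

End subharmonic.

Section psh.
Context {R : realType} {n : nat}.
Implicit Types (D : set 'rV[R[i]^o]_n) (u v : 'rV[R[i]^o]_n -> \bar R).

Lemma pshZ D u (k : R) : 0 < k -> (forall z, D z -> u z <= 0)%E ->
  psh D u -> psh D (fun z => k%:E * u z)%E.
Proof.
move=> k0 u0 [ufin uu ul]; split.
- move=> z Dz; apply: (@le_lt_trans _ _ 0%E) => //.
  by apply: mule_ge0_le0; [rewrite lee_fin ltW | exact: u0].
- exact: usc_onZ.
- by move=> a b; apply: subharmonicZ => // z; exact: u0.
Qed.

Lemma pshD D u v : (forall z, D z -> u z <= 0)%E -> (forall z, D z -> v z <= 0)%E ->
  psh D u -> psh D v -> psh D (fun z => u z + v z)%E.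
Proof.
move=> u0 v0 [ufin uu ul] [vfin vu vl]; split.
- by move=> z Dz; apply: lte_add_pinfty; [exact: ufin | exact: vfin].
- exact: usc_onD.
- by move=> a b; apply: subharmonicD => // z; [exact: u0 | exact: v0].
Qed.

Lemma psh_sup (I : Type) D (v : I -> 'rV[R[i]^o]_n -> \bar R) :
  (forall j, psh D (v j)) ->
  (forall z, D z -> ereal_sup (range (v ^~ z)) < +oo)%E ->
  usc_on D (fun z => ereal_sup (range (v ^~ z))) ->
  psh D (fun z => ereal_sup (range (v ^~ z))).
Proof.
move=> vsh vfin vu; split => // a b.
apply: (@subharmonic_sup _ _ _ (fun j w => v j (a + w *: b))).
- by move=> j; have [_ _] := vsh j; exact.
- by move=> z; exact: vfin.
- exact: (@usc_on_comp R _ _ _ D _ (@continuous_line R n a b) vu).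
Qed.

End psh.

(** * The identity principle for the value -oo *)

Section propagation.
Context {R : realType} {n : nat}.
Implicit Types (D : set 'rV[R[i]^o]_n) (u : 'rV[R[i]^o]_n -> \bar R).

(** The circle through q centered at a, in the complex line joining them, has an
    arc around q on which u is -oo, so its mean is -oo and bounds u a from above.
    The fraction e / 4 keeps the whole disc inside D: its points are within
    e / 4 + 2 * (e / 4) < e of p. *)
Lemma psh_Noo_spread D u (p q a : 'rV[R[i]^o]_n) (e : R[i]) :
  psh D u -> (forall z, D z -> u z <= 0)%E -> [set z | `|p - z| < e] `<=` D ->
  `|p - q| < e / 4 -> `|p - a| < e / 4 ->
  (\forall z \near q, u z = -oo%E) -> u a = -oo%E.
Proof.
move=> [_ _ ush] u0 eD pq pa uq.
have e0 : 0 < e.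
  have := le_lt_trans (normr_ge0 _) pa.
  by rewrite pmulr_lgt0// invr_gt0 ltr0n.
have qa : `|q - a| < e / 4 + e / 4.
  rewrite (_ : q - a = (p - a) - (p - q)); last by rewrite opprB [RHS]addrC addrA subrK.
  by apply: le_lt_trans (ler_normB _ _) _; exact: ltrD.
have disc : [set z : R[i]^o | `|z - 0| <= 1%:C] `<=` [set w | D (a + w *: (q - a))].
  move=> w /=; rewrite subr0 => w1; apply: eD => /=.
  rewrite opprD addrA; apply: le_lt_trans (ler_normB _ _) _.
  rewrite (_ : e = e / 4 + (e / 4 + e / 4 + e / 4)); last by field.
  apply: ltrD => //; rewrite normrZ.
  apply: (@le_lt_trans _ _ `|q - a|); first by rewrite ler_piMl.
  by apply: lt_trans qa _; rewrite ltrDl divr_gt0// ltr0n.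
have [_ _ um] := ush a (q - a).
have := um 0 1 ltr01 disc.
rewrite scale0r addr0 => ua.
apply/eqP; rewrite -leeNy_eq; apply: le_trans ua _.
have := @continuous_circle_line R n a (q - a) 0 1 0.
rewrite /continuous_at cos0 sin0 (_ : (1 +i* 0 : R[i]) = 1)// mulr1 add0r.
rewrite (_ : 1%:C = 1 :> R[i])// scale1r [a + (q - a)]addrC subrK => cq.
have [d /= d0 dH] := cq _ uq.
rewrite (@circle_mean_Noo _ _ _ _ (d / 2))// ?divr_gt0//.
- by move=> t; apply: u0; apply: disc; exact: disc_circle.
- move=> t /andP[t0 td]; apply: dH; rewrite /= sub0r normrN ger0_norm//.
  by apply: le_lt_trans td _; rewrite gtr_pMr// invf_lt1// ltr1n.
Qed.

(** The interior of the set where u is -oo is relatively closed in D by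
    psh_Noo_spread, so connectedness gives the whole of D. *)
Lemma psh_Noo_open D u : open D -> connected D -> psh D u ->
  (forall z, D z -> u z <= 0)%E -> forall q, D q ->
  (\forall z \near q, u z = -oo%E) -> forall z, D z -> u z = -oo%E.
Proof.
move=> oD cD ush u0 q Dq uq.
pose E : set 'rV[R[i]^o]_n := [set z | \forall y \near z, u y = -oo%E].
suff DE : D `&` E = D.
  by move=> z; rewrite -DE => -[_ /nbhs_singleton].
apply: cD.
- by exists q.
- exists E => //; rewrite openE => z Ez; rewrite /interior /=.
  exact: (near_join Ez).
- exists (closure E); first exact: closed_closure.
  apply/seteqP; split => p [Dp Ep]; first by split; [exact: Dp | exact: subset_closure].
  split; first exact: Dp.
  have /nbhs_normP[e /= e0 eD] : nbhs p D by exact: open_nbhs_nbhs.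
  have e4 : 0 < e / 4 by rewrite divr_gt0// ltr0n.
  have nb : nbhs p [set z | `|p - z| < e / 4].
    by apply/(@nbhs_normP _ 'rV[R[i]^o]_n p); exists (e / 4).
  have [q' [Eq' pq']] := Ep _ nb.
  apply: filterS nb => a pa.
  exact: (psh_Noo_spread ush u0 eD pq' pa).
Qed.

End propagation.

(** * Peak functions at boundary points of B-regular domains *)

Section peak.
Context {R : realType} {n : nat}.
Implicit Types (D : set 'rV[R[i]^o]_n).

(** The square of the sup norm can replace the Euclidean one because its circle
    means are only needed in complex lines through the origin, where homogeneity
    (sqnormZ) makes it a multiple of the squared modulus. *)
Definition sqnorm (z : 'rV[R[i]^o]_n) : R := (Re `|z|) ^+ 2.

Lemma continuous_sqnorm (z0 : 'rV[R[i]^o]_n) :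
  continuous (fun z : 'rV[R[i]^o]_n => sqnorm (z - z0) : R^o).
Proof.
move=> z.
have c1 : {for z, continuous (fun z : 'rV[R[i]^o]_n => z - z0)}.
  have cid : (fun w : 'rV[R[i]^o]_n => w) @ z --> z by exact: cvg_id.
  exact: (@cvgB _ 'rV[R[i]^o]_n _ _ _ _ _ _ _ cid (cvg_cst z0)).
have c2 : {for z - z0, continuous (fun w : 'rV[R[i]^o]_n => `|w| : R[i]^o)}.
  exact: norm_continuous.
have c3 := @continuous_Re R `|z - z0|.
have := continuous_comp (continuous_comp c1 c2) c3.
rewrite /continuous_at => H; exact: (cvgM H H).
Qed.

Lemma sqnormZ (w : R[i]^o) (z : 'rV[R[i]^o]_n) :
  sqnorm (w *: z) = (Re w ^+ 2 + Im w ^+ 2) * sqnorm z.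
Proof.
rewrite /sqnorm normrZ normc_def.
have zr : `|z| = (Re `|z|)%:C by rewrite RRe_real.
rewrite {1}zr -rmorphM /= exprMn sqr_sqrtr//.
by rewrite addr_ge0// sqr_ge0.
Qed.

Lemma sqnorm_gt0 (z : 'rV[R[i]^o]_n) : z != 0 -> 0 < sqnorm z.
Proof.
move=> z0; rewrite exprn_gt0//.
by rewrite -ltcR RRe_real// normr_gt0.
Qed.

(** Let c be a maximum point of G = phi + sqnorm (_ - z0) on the compact closure
    of D, and suppose that c lies in D. On the line w |-> c + w * (c - z0) the
    second summand is |1 + w|^2 * S with S > 0, whose mean over the circle of
    radius r around 0 exceeds its value at 0 by r^2 * S. Since G <= G c, the mean
    of phi is at most phi c - r^2 * S, against subharmonicity. *)
Lemma psh_le_sqnorm D (phi : 'rV[R[i]^o]_n -> R) (z0 : 'rV[R[i]^o]_n) :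
  open D -> bounded_set D -> ~ D z0 ->
  psh D (EFin \o phi) -> {within closure D, continuous phi} ->
  (forall x, bdry D x -> phi x <= - sqnorm (x - z0)) ->
  forall z, closure D z -> phi z <= - sqnorm (z - z0).
Proof.
move=> oD bD Dz0 [_ _ phish] cphi phib.
pose G z := phi z + sqnorm (z - z0).
have cG : {within closure D, continuous (G : _ -> R^o)}.
  move=> x; apply: (@cvgD _ R^o); first exact: cphi.
  have /(@continuous_subspaceT _ _ (closure D)) cs := @continuous_sqnorm z0.
  exact: cs.
move=> z cDz; suff : G z <= 0 by rewrite /G -lerBrDr sub0r.
have [c /set_mem cDc cmax] : exists2 c, c \in closure D & forall t, t \in closure D -> G t <= G c.
  apply: compact_EVT_max => //; first by exists z.
  by apply: closed_bounded_compact_complex; [exact: bounded_closure | exact: closed_closure].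
apply: le_trans (cmax z (mem_set cDz)) _.
have [Dc|nDc] := pselect (D c); last first.
  rewrite /G -lerBrDr sub0r; apply: phib; split => //.
  by rewrite (interior_id D).1.
pose S := sqnorm (c - z0).
have S0 : 0 < S.
  by apply: sqnorm_gt0; rewrite subr_eq0; apply: contra_not_neq Dz0 => <-.
have [r r0 rD] : exists2 r : R, 0 < r &
    [set w : R[i]^o | `|w - 0| <= r%:C] `<=` [set w | D (c + w *: (c - z0))].
  have := @continuous_line R n c (c - z0) 0.
  rewrite /continuous_at scale0r addr0 => /(_ _ (open_nbhs_nbhs (conj oD Dc))).
  move=> /nbhs_normP[e /= e0 eD].
  have ee : e = (Re e)%:C by rewrite RRe_real// gtr0_real.
  have e0' : 0 < Re e by rewrite -ltcR -ee.
  exists (Re e / 2); first by rewrite divr_gt0.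
  move=> w /= w1; apply: eD => /=; rewrite distrC; apply: le_lt_trans w1 _.
  by rewrite [ltRHS]ee ltcR ltr_pdivrMr// ltr_pMr// ltr1n.
have [_ _ um] := phish c (c - z0).
have := um 0 r r0 rD; rewrite /= scale0r addr0 leNgt => /negP[].
have GE w : G c - (S * ((1 + Re w) ^+ 2 + Im w ^+ 2)) = G c - sqnorm (c + w *: (c - z0) - z0).
  rewrite (_ : c + w *: (c - z0) - z0 = (1 + w) *: (c - z0)); last first.
    by rewrite scalerDl scale1r addrAC.
  by rewrite sqnormZ [Re (1 + w)]raddfD [Im (1 + w)]raddfD /= add0r [S * _]mulrC.
apply: (@le_lt_trans _ _ (circle_mean (fun w => (G c - S * ((1 + Re w) ^+ 2 + Im w ^+ 2))%:E) 0 r)).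
  apply: le_circle_mean => t; rewrite lee_fin GE lerBrDr.
  apply/cmax/mem_set/subset_closure/rD; exact: disc_circle.
(* |1 + r exp(it)|^2 = 1 + r^2 + 2 r cos t, and the cosine averages to 0 *)
rewrite (@circle_mean_affine_cos _ _ _ _ (G c - S * (1 + r ^+ 2)) (- (2 * r * S))).
  rewrite lte_fin /G -/S.
  by rewrite ltrBlDr ltrD2l mulrDr mulr1 ltrDl mulr_gt0// exprn_gt0.
move=> t /=; congr EFin; rewrite !(mul0r, add0r, subr0, addr0).
by rewrite [(r * sin t) ^+ 2]exprMn sin2cos2; ring.
Qed.

Lemma B_regular_peak D (z0 : 'rV[R[i]^o]_n) : B_regular D -> bdry D z0 ->
  exists phi : 'rV[R[i]^o]_n -> R,
    [/\ psh D (EFin \o phi), {within closure D, continuous phi}, phi z0 = 0 &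
        forall z, D z -> phi z <= - sqnorm (z - z0)].
Proof.
move=> [[oD cD _] bD ext] bz0.
have nDz0 : ~ D z0 by case: bz0 => _; rewrite (interior_id D).1.
have cf : {within bdry D, continuous (fun z : 'rV[R[i]^o]_n => - sqnorm (z - z0) : R^o)}.
  apply: continuous_subspaceT => z.
  exact: (@cvgN _ R^o _ _ _ _ _ (@continuous_sqnorm z0 z)).
have [phi [phish cphi phiE]] := ext _ cf.
exists phi; split => //.
  by rewrite phiE// subrr /sqnorm normr0 /= expr0n oppr0.
move=> z Dz; apply: (psh_le_sqnorm oD bD) => //; last exact: subset_closure.
by move=> x bx; rewrite phiE.
Qed.

End peak.

(** * Upper semicontinuous regularization *)

Section usc_regularization.
Context {R : realType} {n : nat}.
Implicit Types (D : set 'rV[R[i]^o]_n) (u : 'rV[R[i]^o]_n -> \bar R).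

Lemma usc_reg_NooP D u x : usc_reg D u x = -oo%E <->
  forall M : R, \forall y \near within D (nbhs x), (u y <= M%:E)%E.
Proof.
rewrite /usc_reg limf_esupE; split => [uoo M|uM].
  have : (ereal_inf [set ereal_sup (u @` V) | V in within D (nbhs x)] < M%:E)%E.
    by rewrite uoo ltNyr.
  move=> /ereal_inf_lt[_ [V DV <-] VM].
  apply: filterS DV => y Vy; apply: ltW; apply: le_lt_trans VM.
  by apply: ereal_sup_ubound; exists y.
apply: oppe_inj; apply/eqyP => M _; rewrite leeNr -EFinN.
apply: ge_ereal_inf.
exists (ereal_sup (u @` [set y | (u y <= (- M)%:E)%E])).
  by exists [set y | (u y <= (- M)%:E)%E] => //; exact: uM.
by apply: ge_ereal_sup => _ [y yM <-].
Qed.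

Lemma usc_reg_ge D u x (m : \bar R) :
  (forall V, nbhs x V -> exists y, [/\ D y, V y & (m <= u y)%E]) ->
  (m <= usc_reg D u x)%E.
Proof.
move=> H; rewrite /usc_reg limf_esupE; apply: le_ereal_inf_tmp => _ [V DV <-].
have [y [Dy Vy my]] := H _ DV.
by apply: le_trans my _; apply: ereal_sup_ubound; exists y => //; exact: Vy.
Qed.

(** Otherwise u is -oo near a point of D, hence on D by the identity principle. *)
Lemma psh_finite_near_closure D u z0 V : domain D -> psh D u ->
  (forall z, D z -> u z <= 0)%E -> not_identically_Noo D u ->
  closure D z0 -> nbhs z0 V -> exists z, [/\ D z, V z & u z != -oo%E].
Proof.
move=> [oD cD _] ush u0 [w Dw uw] cDz0 nV.
apply: contrapT => nex.
have [q [Dq Vq]] := cDz0 _ (nbhs_interior nV).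
have uq : \forall z \near q, u z = -oo%E.
  have nD : nbhs q D by exact: open_nbhs_nbhs.
  apply: filterS2 nD Vq => z Dz Vz; apply/eqP; apply: contrapT => /negP uz.
  by apply: nex; exists z.
by move: uw; rewrite (psh_Noo_open oD cD ush u0 Dq uq Dw) eqxx.
Qed.

End usc_regularization.

(** * Penalized suprema *)

(** The uniform bound - (j + 1) * d makes all but finitely many indices
    irrelevant at level c, and finitely many neighbourhoods can be intersected. *)
Lemma near_ereal_sup_le {R : realType} {T : Type} (F : set_system T) {FF : Filter F}
    (v : nat -> T -> \bar R) (d c : R) : 0 < d ->
  (\forall y \near F, forall j, (v j y <= (- (j.+1%:R * d))%:E)%E) ->
  (forall j, \forall y \near F, (v j y <= c%:E)%E) ->
  \forall y \near F, (ereal_sup (range (v ^~ y)) <= c%:E)%E.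
Proof.
move=> d0 Hd Hc.
pose J := Num.truncn (- c / d).
have HJ : \forall y \near F, forall j, (j < J)%N -> (v j y <= c%:E)%E.
  elim: J => [|J IH]; first by apply: filterE.
  apply: filterS2 IH (Hc J) => y yJ yc j.
  by rewrite ltnS leq_eqVlt => /predU1P[->//|]; exact: yJ.
apply: filterS2 Hd HJ => y yd yJ; apply: ge_ereal_sup => _ [j _ <-].
have [/yJ//|Jj] := ltnP j J.
apply: le_trans (yd j) _; rewrite lee_fin lerNl -ler_pdivrMr//.
apply: ltW; apply: lt_le_trans (truncnS_gt _) _.
by rewrite ler_nat ltnS.
Qed.

Section penalized_sup.
Context {R : realType} {n : nat}.
Context (D : set 'rV[R[i]^o]_n) (z0 : 'rV[R[i]^o]_n).
Context (u : 'rV[R[i]^o]_n -> \bar R) (phi : 'rV[R[i]^o]_n -> R) (e : nat -> R).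
Context (Dz0 : ~ D z0).
Context (ush : psh D u) (u0 : forall z, D z -> (u z <= 0)%E).
Context (phish : psh D (EFin \o phi))
  (phile : forall z, D z -> phi z <= - sqnorm (z - z0)).
Context (e0 : forall j, 0 < e j).

(** The small factor e j preserves the poles of u while making its values at
    chosen points bounded; the growing multiple of phi forces the functions
    down everywhere except near z0. *)
Definition penalized (j : nat) (z : 'rV[R[i]^o]_n) : \bar R :=
  ((e j)%:E * u z + j.+1%:R%:E * (phi z)%:E)%E.

Definition penalized_sup (z : 'rV[R[i]^o]_n) : \bar R :=
  ereal_sup (range (penalized ^~ z)).

Let phi0 z : D z -> ((phi z)%:E <= 0)%E.
Proof. by move=> Dz; rewrite lee_fin (le_trans (phile Dz))// oppr_le0 sqr_ge0. Qed.

Let penalized_le_phi j z : D z -> (penalized j z <= (j.+1%:R * phi z)%:E)%E.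
Proof.
move=> Dz; rewrite /penalized -EFinM geeDr//.
by apply: mule_ge0_le0; [rewrite lee_fin ltW | exact: u0].
Qed.

Let penalized_le_u j z : D z -> (penalized j z <= (e j)%:E * u z)%E.
Proof.
by move=> Dz; rewrite /penalized geeDl// mule_ge0_le0 ?phi0.
Qed.

Let psh_penalized j : psh D (penalized j).
Proof.
apply: (pshD (u := fun z => ((e j)%:E * u z)%E) (v := fun z => (j.+1%:R%:E * (phi z)%:E)%E)).
- by move=> z Dz; apply: mule_ge0_le0; [rewrite lee_fin ltW | exact: u0].
- by move=> z Dz; apply: mule_ge0_le0 => //; exact: phi0.
- exact: pshZ.
- exact: (@pshZ _ _ _ (EFin \o phi)).
Qed.

Lemma near_penalized_sup_le x (c : R) : x <> z0 ->
  (forall j, \forall y \near within D (nbhs x), (penalized j y <= c%:E)%E) ->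
  \forall y \near within D (nbhs x), (penalized_sup y <= c%:E)%E.
Proof.
move=> /eqP xz0 Hc.
have s0 : 0 < sqnorm (x - z0) by apply: sqnorm_gt0; rewrite subr_eq0.
have d0 : 0 < sqnorm (x - z0) / 2 by rewrite divr_gt0.
apply: (near_ereal_sup_le d0 _ Hc).
(* near x, phi is at most minus half the squared distance from x to z0 *)
have H := @continuous_sqnorm R n z0 x.
have {}H : \forall y \near x, sqnorm (x - z0) / 2 < sqnorm (y - z0).
  by apply: (cvgr_gt _ H); rewrite ltr_pdivrMr// ltr_pMr// ltr1n.
apply: filterS H => y ys Dy j.
apply: le_trans (penalized_le_phi j Dy) _.
rewrite lee_fin -mulrN ler_wpM2l//; apply: le_trans (phile Dy) _.
by rewrite lerN2 ltW.
Qed.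

Lemma penalized_sup_lt0 z : D z -> (penalized_sup z < 0)%E.
Proof.
move=> Dz; apply: (@le_lt_trans _ _ (phi z)%:E).
  apply: ge_ereal_sup => _ [j _ <-]; apply: le_trans (penalized_le_phi j Dz) _.
  by rewrite lee_fin ler_neMl ?ler1n// -lee_fin phi0.
rewrite lte_fin (le_lt_trans (phile Dz))// oppr_lt0 sqnorm_gt0// subr_eq0.
by apply: contra_not_neq Dz0 => <-.
Qed.

Lemma psh_penalized_sup : psh D penalized_sup.
Proof.
apply: psh_sup => //.
  by move=> z Dz; apply: lt_trans (penalized_sup_lt0 Dz) _; exact: ltry.
move=> x Dx c vc.
(* near_penalized_sup_le yields a non-strict inequality: leave room below c *)
have [c' c'c vc'] : exists2 c' : R, c' < c & (penalized_sup x < c'%:E)%E.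
  move: vc; rewrite -/(penalized_sup x); case: (penalized_sup x) => [r||]//.
    by rewrite lte_fin => rc; exists ((r + c) / 2); rewrite ?lte_fin; lra.
  by move=> _; exists (c - 1); [lra | exact: ltNyr].
have : \forall y \near within D (nbhs x), (penalized_sup y <= c'%:E)%E.
  apply: near_penalized_sup_le => [xz0|j]; first by apply: Dz0; rewrite -xz0.
  have [_ us _] := psh_penalized j.
  have /(us x Dx) : (penalized j x < c'%:E)%E.
    by apply: le_lt_trans vc'; apply: ereal_sup_ubound; exists j.
  by apply: filterS => y /ltW.
by apply: filterS => y yc; apply: le_lt_trans yc _; rewrite lte_fin.
Qed.

Lemma usc_reg_penalized_sup_Noo a : a <> z0 -> usc_reg D u a = -oo%E ->
  usc_reg D penalized_sup a = -oo%E.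
Proof.
move=> az0 /usc_reg_NooP ua; apply/usc_reg_NooP => M.
apply: near_penalized_sup_le => // j.
have H : \forall y \near a, D y -> (u y <= (M / e j)%:E)%E by exact: ua.
apply: filterS H => y uy Dy.
apply: le_trans (penalized_le_u j Dy) _.
apply: le_trans (lee_wpmul2l _ (uy Dy)) _; first by rewrite lee_fin ltW.
by rewrite -EFinM mulrCA mulfV ?mulr1// gt_eqF.
Qed.

End penalized_sup.

Theorem proposition3p7 (R : realType) (n : nat) (D A : set 'rV[R[i]^o]_n)
  (hD : B_regular D) (hA : b_pluripolar D A) :
  b_hull D A `&` bdry D = A.
Proof.
have [Abdry [u [ush u0 unoo uA]]] := hA.
apply/seteqP; split => [z0 [[cDz0 hull] bz0]|a Aa]; last first.
  have ba := Abdry _ Aa; split => //; split; first by case: ba.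
  by move=> w _ _ _; exact.
apply: contrapT => nAz0.
have [phi [phish cphi phiz0 phile]] := B_regular_peak hD bz0.
have [[oD cD D0] _ _] := hD.
have Dz0 : ~ D z0 by case: bz0 => _; rewrite (interior_id D).1.
(* the points approaching z0 at which u is finite and phi is almost 0 *)
have /choice[zs zsP] : forall j : nat, exists z,
    [/\ D z, `|z0 - z| < j.+1%:R^-1, - j.+1%:R^-1 < phi z & u z != -oo%E].
  move=> j.
  have nb : nbhs z0 [set z | `|z0 - z| < j.+1%:R^-1].
    by apply/(@nbhs_normP _ 'rV[R[i]^o]_n z0); exists (j.+1%:R^-1) => //=; rewrite invr_gt0.
  have cz0 : phi @ within (closure D) (nbhs z0) --> (0 : R).
    by rewrite -phiz0; move/subspace_continuousP : cphi; exact.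
  have np : \forall z \near within (closure D) (nbhs z0), - j.+1%:R^-1 < phi z.
    by apply: (cvgr_gt _ cz0); rewrite oppr_lt0 invr_gt0.
  have [z [Dz [zb zphi] uz]] :=
    psh_finite_near_closure (And3 oD cD D0) ush u0 unoo cDz0 (filterI nb np).
  by exists z; split => //; apply: zphi; exact: subset_closure.
(* so that e j * u (zs j) >= -1 *)
pose e j := (1 + `|fine (u (zs j))|)^-1.
have e0 j : 0 < e j by rewrite invr_gt0 ltr_pwDl.
have vz j : ((- 2)%:E <= penalized_sup u phi e (zs j))%E.
  have [Dz _ zphi uz] := zsP j.
  apply: (@le_trans _ _ (penalized u phi e j (zs j))); last first.
    by apply: ereal_sup_ubound; exists j.
  have ur : u (zs j) = (fine (u (zs j)))%:E.
    rewrite fineK// fin_numE uz /=; apply/negP => /eqP uy.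
    by have := u0 _ Dz; rewrite uy.
  rewrite /penalized ur -!EFinM -EFinD lee_fin.
  rewrite (_ : - 2 = - 1 + - 1); last by rewrite -opprD.
  apply: lerD.
    rewrite /e mulrC ler_pdivlMr ?ltr_pwDl// mulN1r opprD.
    apply: le_trans (lerNnormlW (lexx _)); lra.
  rewrite mulrC -ler_pdivrMr// mulN1r; exact: ltW.
have vz0 : usc_reg D (penalized_sup u phi e) z0 = -oo%E.
  apply: hull.
  - exact: psh_penalized_sup Dz0 ush u0 phish phile e0.
  - exists (zs 0%N); first by case: (zsP 0%N).
    by apply/eqP => v0; have := vz 0%N; rewrite v0.
  - exact: penalized_sup_lt0 Dz0 u0 phile e0.
  - move=> a Aa; apply: (usc_reg_penalized_sup_Noo u0 phile e0); last exact: uA.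
    by move=> az0; apply: nAz0; rewrite -az0.
suff : ((- 2)%:E <= usc_reg D (penalized_sup u phi e) z0)%E by rewrite vz0.
apply: usc_reg_ge => V /(@nbhs_normP _ 'rV[R[i]^o]_n z0)[d /= d0 dV].
have dd : d = (Re d)%:C by rewrite RRe_real// gtr0_real.
have d0' : 0 < Re d by rewrite -ltcR -dd.
have [Dz zz0 _ _] := zsP (Num.truncn (Re d)^-1).
exists (zs (Num.truncn (Re d)^-1)); split => //; apply: dV => /=.
apply: lt_trans zz0 _.
rewrite dd -[X in X^-1](rmorph_nat (real_complex R)) -fmorphV ltcR.
by rewrite invf_plt// ?posrE// truncnS_gt.
Qed.
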